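(* Let $\omega=\mathbb{C}^{\mathbb{N}}$ and let $A=(a_{i,j})_{i,j\ge 1}\in L(\omega)$ be lower triangular (that is, $a_{i,j}=0$ whenever $j>i$). Then $A$ is recurrent if and only if $A=BDB^{-1}$, where $D$ is a diagonal matrix whose diagonal entries all have modulus $1$, and $B$ and its inverse $B^{-1}$ are in $L(\omega)$.
   Context: $\omega=\mathbb{C}^{\mathbb{N}}$ carries the product topology, which makes it a Fréchet space. $L(\omega)$ denotes the space of continuous linear operators from $\omega$ to itself; operators are identified with their representing infinite matrices with respect to the canonical basis $\{e_k:k=1,2,\dots\}$ (the $k$th coordinate of $e_k$ is $1$, all others are $0$), so that $(Ax)_i=\sum_j a_{i,j}x_j$. An infinite matrix represents an element of $L(\omega)$ if and only if each of its rows has only finitely many nonzero entries. A continuous linear operator $T$ on a Fréchet space $X$ is called recurrent if for every nonempty open set $U\subset X$ there is a positive integer $k$ with $U\cap T^{-k}(U)\neq\emptyset$ (equivalently, the set of vectors $x$ for which there is a strictly increasing sequence of positive integers $(k_n)$ with $T^{k_n}x\to x$ is dense in $X$). A diagonal matrix is one all of whose entries off the main diagonal are $0$. *)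

(* Defs.v *)
From HB Require Import structures.
From mathcomp Require Import all_boot all_order all_algebra.
From mathcomp Require Import complex.
From mathcomp Require Import all_classical all_reals all_analysis.

Set Implicit Arguments.
Unset Strict Implicit.
Unset Printing Implicit Defensive.

Import Order.TTheory GRing.Theory Num.Theory numFieldNormedType.Exports.
Local Open Scope classical_set_scope.
Local Open Scope ring_scope.

(* The type is ascribed so that the norm topology of a numClosedFieldType is
   found; it is not inferred on the bare type R[i]. *)
Definition C (R : realType) : numClosedFieldType := R[i].

(* Coordinates are numbered from 0 instead of 1. *)
Definition omega (R : realType) := {ptws nat -> C R}.

HB.instance Definition _ (R : realType) := Uniform.on (omega R).
HB.instance Definition _ (R : realType) :=
  GRing.Lmodule.copy (omega R) (nat -> C R).

(* Membership in L(omega). *)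
Definition is_cont_linear (R : realType) (T : omega R -> omega R) : Prop :=
  linear T /\ continuous T.

Definition basis_vec (R : realType) (k : nat) : omega R :=
  fun i => (i == k)%:R.

(* An operator of L(omega) is determined by its matrix entries
   a_(i,j) = (T e_j)_i. *)
Definition entry (R : realType) (T : omega R -> omega R) (i j : nat) : C R :=
  T (basis_vec R j) i.

Definition is_lower_triangular (R : realType) (T : omega R -> omega R) : Prop :=
  forall i j : nat, (i < j)%N -> entry T i j = 0.

Definition is_diagonal (R : realType) (T : omega R -> omega R) : Prop :=
  forall i j : nat, i != j -> entry T i j = 0.

Definition recurrent (X : topologicalType) (T : X -> X) : Prop :=
  forall U : set X, open U -> U !=set0 ->
    exists2 k : nat, (0 < k)%N & U `&` (iter k T @^-1` U) !=set0.

(* Main.v *)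
Require Import Defs.
From mathcomp Require Import all_boot all_order all_algebra.
From mathcomp Require Import complex.
From mathcomp Require Import all_classical all_reals all_analysis.
From mathcomp Require Import ring lra.

(** Write lam_n for the diagonal entries of A. The proof diagonalizes A by rows
rather than by columns: coordinate functionals f_0, f_1, f_2, ... are built
one after the other, each of the form
  f_n = e_n + sum_(j < n) c_(n,j) f_j   (e_n is the n-th coordinate),
so that f_n (A x) = lam_n f_n(x). The map Binv : x |-> (f_n(x))_n is then
conjugation to the diagonal operator with entries lam_n, and its inverse is
explicit: B y = (y_n - sum_(j < n) c_(n,j) y_j)_n.

Row n of A, rewritten in the functionals already known, reads
  e_n (A x) = lam_n e_n(x) + sum_(j < n) d_j f_j(x),
so f_n is an eigenfunctional if c_(n,j) (lam_n - lam_j) = d_j for all j < n.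
This fixes c_(n,j) when lam_j <> lam_n. The terms with lam_j = lam_n cannot be
removed; they add up to a functional h with
  h (A x) = lam_n h(x)   and   f_n (A x) = lam_n f_n(x) + h(x),
a Jordan block of size two ([unitri_inv_step], [obstruction_eigen]).

Recurrence passes to functionals that A multiplies by a scalar. If f o A = lam f
with f continuous and onto, then |lam| = 1, since otherwise |f| leaves a suitable
annulus at the first step and never returns ([recurrent_eigenvalue]). If h were
nonzero, then |f_n(A^k x)| would grow like k |h(x)|, so the open set
{|h| > 1, |f_n| < 1/2} would never return to itself ([recurrent_no_jordan]).
Hence h = 0, every f_n is an eigenfunctional, and |lam_n| = 1.

Conversely recurrence is invariant under conjugation, and a diagonal operator
with unimodular entries is recurrent: by the pigeonhole principle any finitely
many unimodular numbers have a common power close to 1 ([unit_powers_return]),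
and neighbourhoods in the product topology restrict finitely many coordinates. *)

Set Implicit Arguments.
Unset Strict Implicit.
Unset Printing Implicit Defensive.

Import Order.TTheory GRing.Theory Num.Theory numFieldNormedType.Exports.
Local Open Scope classical_set_scope.
Local Open Scope ring_scope.

(** * Coordinatewise topology of omega *)

Lemma cvg_omegaP (R : realType) (F : set_system (omega R)) (x : omega R) :
  Filter F -> (F --> x) <-> (forall i, (y i @[y --> F]) --> x i).
Proof. by move=> FF; have := @pointwise_cvgP nat (C R : uniformType) F x FF. Qed.

Lemma omega_coord_continuous (R : realType) (i : nat) :
  continuous (fun x : omega R => x i).
Proof. by have := @proj_continuous nat (fun=> (C R : uniformType)) i. Qed.

Lemma continuous_omegaP (R : realType) (X : topologicalType) (T : X -> omega R) :
  continuous T <-> (forall i, continuous (fun x => T x i)).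
Proof.
split=> [cT i x|cT x].
  exact: (continuous_comp (cT x) (@omega_coord_continuous R i (T x))).
have [_ h] := @cvg_omegaP R (fmap T (nbhs x)) (T x) (fmap_filter _ _).
by apply: h => i; exact: cT.
Qed.

Lemma continuous_scale (T : topologicalType) (K : numFieldType) (f : T -> K) (c : K) :
  continuous f -> continuous (fun x => c * f x).
Proof. by move=> cf x; apply: cvgM; [exact: cvg_cst|exact: cf]. Qed.

Lemma continuous_lin_comb (T : topologicalType) (K : numFieldType) (f : nat -> T -> K)
    (c : nat -> K) (n : nat) :
  (forall j, (j < n)%N -> continuous (f j)) ->
  continuous (fun x => \sum_(j < n) c j * f j x).
Proof.
move=> cf x.
apply: cvg_big => [|j _]; first exact: add_continuous.
exact: continuous_scale (cf _ (ltn_ord j)) x.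
Qed.

Lemma continuous_add_lin_comb (T : topologicalType) (K : numFieldType)
    (g : T -> K) (f : nat -> T -> K) (c : nat -> K) (n : nat) :
  continuous g -> (forall j, (j < n)%N -> continuous (f j)) ->
  continuous (fun x => g x + \sum_(j < n) c j * f j x).
Proof. by move=> cg cf x; apply: cvgD (cg x) _; exact: continuous_lin_comb. Qed.

Lemma open_norm_gt (T : topologicalType) (K : numFieldType) (f : T -> K) (r : K) :
  continuous f -> open [set x | r < `|f x|].
Proof.
move=> cf; apply: (@open_comp _ _ f [set z | r < `|z|]) => [x _|]; first exact: cf.
rewrite openE => z /= rz; apply/nbhs_ballP; exists (`|z| - r) => [/=|w /= zw].
  by rewrite subr_gt0.
have := le_lt_trans (lerB_dist z w) zw.
by rewrite ltrD2l ltrN2.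
Qed.

Lemma open_norm_lt (T : topologicalType) (K : numFieldType) (f : T -> K) (r : K) :
  continuous f -> open [set x | `|f x| < r].
Proof.
move=> cf; apply: (@open_comp _ _ f [set z | `|z| < r]) => [x _|]; first exact: cf.
rewrite openE => z /= zr; apply/nbhs_ballP; exists (r - `|z|) => [/=|w /= zw].
  by rewrite subr_gt0.
have := le_lt_trans (lerB_dist w z); rewrite distrC => /(_ _ zw).
by rewrite ltrD2r.
Qed.

(** The truncations of [x] converge to [x] coordinatewise, and on them [A] acts by
its matrix; once [m] coordinates are kept the truncated value no longer moves. *)
Lemma cont_linear_row (R : realType) (A : omega R -> omega R) (i m : nat) :
  is_cont_linear A -> (forall j, (m <= j)%N -> entry A i j = 0) ->
  forall x, A x i = \sum_(j < m) entry A i j * x j.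
Proof.
move=> [linA cA] A0 x.
pose P n : omega R := \sum_(j < n) x j *: basis_vec R j.
have A00 : A 0 = 0 by have := linA (-1) 0 0; rewrite scaleN1r oppr0 addr0 scaleN1r addNr.
have PS n : P n.+1 = x n *: basis_vec R n + P n by rewrite /P big_ord_recr addrC.
have P0 : P 0%N = 0 by rewrite /P big_ord0.
have PE n k : P n k = if (k < n)%N then x k else 0.
  elim: n => [|n IH]; first by rewrite P0.
  rewrite PS -[LHS]/(x n * (k == n)%:R + P n k) IH [in RHS]ltnS [in RHS]leq_eqVlt.
  by case: ltngtP => [kn|nk|->]; rewrite ?mulr0 ?mulr1 ?add0r ?addr0.
have AP n : A (P n) i = \sum_(j < n) entry A i j * x j.
  elim: n => [|n IH]; first by rewrite P0 A00 big_ord0.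
  by rewrite PS linA big_ord_recr -IH addrC mulrC.
have cvP : P n @[n --> \oo] --> x.
  apply: (iffRL (@cvg_omegaP R (fmap P \oo) x _)) => k.
  suff : P n k @[n --> \oo] --> x k by [].
  apply: cvg_near_cst; near=> n.
  by rewrite PE ifT //; near: n; exact: nbhs_infty_gt.
have cvAP : A (P n) i @[n --> \oo] --> A x i.
  have := iffLR (continuous_omegaP A) cA i x.
  move=> h; exact: (cvg_comp _ _ cvP h).
apply: (@cvg_unique _ (@norm_hausdorff _ _) _ _ _ _ cvAP).
apply: cvg_near_cst; near=> n.
have mn : (m <= n)%N by near: n; exact: nbhs_infty_ge.
rewrite AP (big_ord_widen _ (fun j => entry A i j * x j) mn) [RHS]big_mkcond.
apply: eq_bigr => j _.
by case: ltnP => // mj; rewrite A0 // mul0r.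
Unshelve. all: by end_near.
Qed.

(** * Recurrence, eigenfunctionals and conjugation *)

Section Recurrence.
Variables (X : topologicalType) (K : numFieldType).
Implicit Types (T : X -> X) (f g : X -> K) (lam : K).

Lemma iter_eigen T f lam k x :
  (forall x, f (T x) = lam * f x) -> f (iter k T x) = lam ^+ k * f x.
Proof.
move=> fT; elim: k => [|k IH]; first by rewrite expr0 mul1r.
by rewrite iterS fT IH exprS mulrA.
Qed.

(** If [`|lam| < 1], each step of [T] shrinks [`|f|] by at least the factor
[`|lam|], so the open annulus [`|lam| < `|f x| < 1] never meets its iterates; for
[`|lam| > 1] the annulus [1 < `|f x| < `|lam|] does the same. *)
Lemma recurrent_eigenvalue T f lam :
  recurrent T -> continuous f -> (forall x, f (T x) = lam * f x) ->
  (forall z, exists x, f x = z) -> `|lam| = 1.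
Proof.
move=> recT cf fT fsurj.
have mid (a b : K) : a < b -> a < (a + b) / 2 < b by move=> ab; rewrite !midf_lt.
have [lt1|gt1|//] := real_ltgtP (normr_real lam) (real1 K); exfalso.
- have [x fx] := fsurj ((`|lam| + 1) / 2).
  have /andP[m1 m2] := mid _ _ lt1.
  have fx0 : `|f x| = (`|lam| + 1) / 2.
    by rewrite fx ger0_norm // divr_ge0 // addr_ge0.
  have [//||[|k] // _ [y [[/= y1 y2] [/= + _]]]] :=
      recT ([set x | `|lam| < `|f x|] `&` [set x | `|f x| < 1]).
  + by apply: openI; [exact: open_norm_gt|exact: open_norm_lt].
  + by exists x; rewrite /= fx0.
  rewrite -iterS (@iter_eigen _ _ lam) // normrM normrX exprS => /lt_geF/negP; apply.
  rewrite -mulrA ler_piMr // mulr_ile1 // ?exprn_ge0 // ?exprn_ile1 // ltW //.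
- have [x fx] := fsurj ((1 + `|lam|) / 2).
  have /andP[m1 m2] := mid _ _ gt1.
  have fx0 : `|f x| = (1 + `|lam|) / 2.
    by rewrite fx ger0_norm // divr_ge0 // addr_ge0.
  have [//||[|k] // _ [y [[/= y1 y2] [/= _ +]]]] :=
      recT ([set x | 1 < `|f x|] `&` [set x | `|f x| < `|lam|]).
  + by apply: openI; [exact: open_norm_gt|exact: open_norm_lt].
  + by exists x; rewrite /= fx0.
  rewrite -iterS (@iter_eigen _ _ lam) // normrM normrX exprS => /lt_geF/negP; apply.
  by rewrite -mulrA ler_peMr // mulr_ege1 // ?exprn_ege1 // ltW.
Qed.

(** Under a Jordan block, [g] grows linearly along the orbits on which [f] is
bounded away from [0]: up to a unimodular factor [g (T^k x)] is [g x] plus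
[k / lam] times [f x]. So points with [`|g x| < 1/2] and [`|f x| > 1] never
come back. *)
Lemma recurrent_no_jordan T f g lam :
  recurrent T -> continuous f -> continuous g -> `|lam| = 1 ->
  (forall x, f (T x) = lam * f x) -> (forall x, g (T x) = lam * g x + f x) ->
  forall x, g x = 0 -> `|f x| <= 1.
Proof.
move=> recT cf cg lam1 fT gT x gx.
(* Multiplying by lam avoids the exponent k - 1 in the power of a Jordan block. *)
have iterg k y : lam * g (iter k T y) = lam ^+ k.+1 * g y + (lam ^+ k * f y) *+ k.
  elim: k => [|k IH]; first by rewrite mulr0n addr0 expr1.
  rewrite iterS gT mulrDr IH (@iter_eigen T f lam k y fT) mulrDr mulrA -exprS.
  rewrite -addrA; congr (_ + _).
  by rewrite -mulrnAr mulrA -exprS mulrnAr mulrA -exprS -mulrSr.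
rewrite real_leNgt ?normr_real //; apply/negP => fx.
have [||k k0 [y [[/= y1 y2] [/= _ y3]]]] :=
    recT ([set x | 1 < `|f x|] `&` [set x | `|g x| < 2^-1]).
- by apply: openI; [exact: open_norm_gt|exact: open_norm_lt].
- by exists x; rewrite /= gx normr0 invr_gt0.
have /(congr1 (fun z => z - lam ^+ k.+1 * g y)) := iterg k y.
rewrite [RHS]addrC addKr => /(congr1 Num.norm).
rewrite normrMn normrM normrX lam1 expr1n mul1r => E.
have : `|f y| *+ k < 1.
  rewrite -E (le_lt_trans (ler_normB _ _)) // !normrM normrX lam1 expr1n !mul1r.
  by rewrite [ltRHS]splitr mul1r ltrD.
apply/negP; rewrite -real_leNgt ?real1 ?realMn ?normr_real //.
rewrite (le_trans (ltW y1)) // -mulr_natr ler_peMr // ler1n //.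
Qed.

End Recurrence.

Lemma recurrent_conj (X Y : topologicalType) (T : X -> X) (B : X -> Y) (Binv : Y -> X) :
  continuous B -> cancel B Binv -> cancel Binv B ->
  recurrent T -> recurrent (B \o T \o Binv).
Proof.
move=> cB BK BinvK recT U oU [u Uu].
have iterE k x : iter k (B \o T \o Binv) (B x) = B (iter k T x).
  by elim: k => //= k ->; rewrite BK.
have [||k k0 [x [/= Ux Ukx]]] := recT (B @^-1` U).
- by apply: open_comp => // x _; exact: cB.
- by exists (Binv u); rewrite /= BinvK.
by exists k => //; exists (B x); split => //=; rewrite iterE.
Qed.

(** * Recurrence of unimodular diagonal operators *)

Lemma pigeonhole_nat (T : finType) (f : nat -> T) :
  exists k l, (k < l)%N /\ f k = f l.
Proof.
pose g (i : 'I_(#|T|.+1)) := f i.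
have /injectivePn[i [j ij gij]] : ~~ injectiveb g.
  by apply/negP => /injectiveP /leq_card; rewrite card_ord ltnn.
case: (ltngtP i j) => [lij|lji|/val_inj eij]; last by rewrite eij eqxx in ij.
  by exists i, j.
by exists j, i.
Qed.

Lemma truncn_eq_dist (R : archiRealFieldType) (x y : R) :
  0 <= x -> 0 <= y -> Num.truncn x = Num.truncn y -> `|x - y| < 1.
Proof.
move=> x0 y0 xy; have /andP[x1 x2] := truncn_itv x0; have /andP[y1 y2] := truncn_itv y0.
rewrite -xy in y1 y2; rewrite -natr1 in x2 y2; rewrite ltr_norml; lra.
Qed.

Lemma norm_le_Re_Im (R : rcfType) (z : R[i]) :
  `|z| <= (`|complex.Re z| + `|complex.Im z|)%:C%C.
Proof.
rewrite normc_def lecR; set s := `|complex.Re z| + _.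
have -> : s = Num.sqrt (s ^+ 2) by rewrite sqrtr_sqr ger0_norm // addr_ge0.
rewrite ler_wsqrtr // /s.
rewrite sqrrD !real_normK ?num_real // addrAC lerDl mulrn_wge0 // mulr_ge0 //.
Qed.

Lemma invn_lt_complex (R : realType) (e : C R) :
  0 < e -> exists m : nat, m.+1%:R^-1 < e.
Proof.
rewrite ltcE => /andP[/eqP /= Im0 Re0].
have -> : e = (complex.Re (e : R[i]))%:C%C by rewrite [LHS]complexE Im0 /= mulr0 addr0.
have := archi_boundP (ltW (etrans (invr_gt0 _) Re0)); set m := Num.bound _ => mP.
exists m; rewrite -(rmorph_nat (real_complex R)) -fmorphV ltcR invf_plt ?posrE ?ltr0n //.
by rewrite (lt_trans mP) // ltr_nat.
Qed.

(** Dirichlet's argument: cut the square [-1, 1]^2 into cells of side [1 / M]. Two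
of the points [(lam i ^+ k)_i] lie in the same cells, and the quotient of
the two powers is the required power close to [1]. *)
Lemma unit_powers_return (R : realType) (n : nat) (lam : nat -> C R) (e : C R) :
  (forall i, `|lam i| = 1) -> 0 < e ->
  exists2 k, (0 < k)%N & forall i, (i < n)%N -> `|lam i ^+ k - 1| < e.
Proof.
move=> lam1 e0.
have [m em] : exists m : nat, m.+1%:R^-1 < e / 2 :> C R.
  by apply: invn_lt_complex; rewrite divr_gt0.
pose M := m.+1.
(* The shift by 1 makes the argument of truncn nonnegative on [-1, 1]. *)
pose cell (t : R) : 'I_(2 * M).+1 := inord (Num.truncn ((t + 1) * M%:R)).
pose F k : {ffun 'I_n -> 'I_(2 * M).+1 * 'I_(2 * M).+1} :=
  [ffun i : 'I_n => (cell (complex.Re (lam i ^+ k : R[i])),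
                     cell (complex.Im (lam i ^+ k : R[i])))].
have [k [l [kl Fkl]]] := pigeonhole_nat F.
exists (l - k)%N => [|i ltin]; first by rewrite subn_gt0.
have pow1 j : `|lam i ^+ j| = 1 by rewrite normrX lam1 expr1n.
have -> : `|lam i ^+ (l - k) - 1| = `|lam i ^+ k - lam i ^+ l|.
  rewrite distrC -[in RHS](subnK (ltnW kl)) exprD -{1}[lam i ^+ k]mul1r.
  by rewrite -mulrBl normrM pow1 mulr1.
have cellP (s t : R) : `|s| <= 1 -> `|t| <= 1 -> cell s = cell t -> `|s - t| < M%:R^-1.
  rewrite !ler_norml => /andP[s1 s2] /andP[t1 t2] /(congr1 val) /=.
  have bnd (u : R) : -1 <= u -> u <= 1 ->
      0 <= (u + 1) * M%:R /\ (Num.truncn ((u + 1) * M%:R) < (2 * M).+1)%N.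
    move=> u1 u2; have u0 : 0 <= (u + 1) * M%:R by rewrite mulr_ge0 //; lra.
    split=> //; rewrite ltnS -(ler_nat R) (le_trans (proj1 (andP (truncn_itv u0)))) //.
    by rewrite natrM ler_wpM2r //; lra.
  have [s0 sb] := bnd s s1 s2; have [t0 tb] := bnd t t1 t2.
  rewrite !inordK // => /(truncn_eq_dist s0 t0).
  rewrite -mulrBl normrM (ger0_norm (ler0n _ _)) -ltr_pdivlMr ?ltr0n // mul1r.
  by rewrite (_ : s + 1 - (t + 1) = s - t) //; ring.
have unit_le1 (z : R[i]) : `|z| = 1 -> `|complex.Re z| <= 1 /\ `|complex.Im z| <= 1.
  move=> z1; have := add_Re2_Im2 z; rewrite z1 expr1n => -[E].
  by split; rewrite -(@expr_le1 _ 2) // real_normK ?num_real // -E ?lerDl ?lerDr sqr_ge0.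
have [Rek Imk] := unit_le1 _ (pow1 k); have [Rel Iml] := unit_le1 _ (pow1 l).
have := congr1 (fun g : {ffun _ -> _} => g (Ordinal ltin)) Fkl.
rewrite !ffunE /= => -[cRe cIm].
apply: (le_lt_trans (norm_le_Re_Im _)).
have -> : e = e / 2 + e / 2 by rewrite -splitr.
have dRe := cellP _ _ Rek Rel cRe.
have dIm := cellP _ _ Imk Iml cIm.
apply: (lt_trans _ (ltrD em em)).
rewrite -(rmorph_nat (real_complex R)) -fmorphV -rmorphD ltcR /=.
by rewrite !raddfB ltrD.
Qed.

Lemma recurrent_diagonal (R : realType) (D : omega R -> omega R) (lam : nat -> C R) :
  (forall i, `|lam i| = 1) -> (forall x i, D x i = lam i * x i) -> recurrent D.
Proof.
move=> lam1 DE U oU [x Ux].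
have iterD k : iter k D x = (fun i => lam i ^+ k * x i).
  elim: k => [|k IH]; apply/funext => i; first by rewrite expr0 mul1r.
  by rewrite iterS DE IH exprS mulrA.
have /choice[k kP] : forall m : nat, exists k,
    (0 < k)%N /\ forall i, (i < m)%N -> `|lam i ^+ k - 1| < m.+1%:R^-1.
  move=> m; have [|k k0 kl] := @unit_powers_return R m lam m.+1%:R^-1 lam1.
    by rewrite invr_gt0 ltr0n.
  by exists k.
have cvk i : lam i ^+ k m @[m --> \oo] --> (1 : C R).
  apply/cvgrPdist_lt => e /invn_lt_complex[p pe].
  near=> m.
  have im : (i < m)%N by near: m; exact: nbhs_infty_gt.
  have pm : (p <= m)%N by near: m; exact: nbhs_infty_ge.
  rewrite distrC (lt_trans ((kP m).2 i im)) // (le_lt_trans _ pe) //.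
  by rewrite lef_pV2 ?posrE ?ltr0n // ler_nat.
have cvD : iter (k m) D x @[m --> \oo] --> x.
  apply: (iffRL (@cvg_omegaP R (fmap (fun m => iter (k m) D x) \oo) x _)) => i.
  suff : iter (k m) D x i @[m --> \oo] --> x i by [].
  rewrite (_ : (fun m => _) = (fun m => lam i ^+ k m * x i)); last first.
    by apply/funext => m; rewrite iterD.
  have h : lam i ^+ k m * x i @[m --> \oo] --> 1 * x i.
    by apply: cvgM; [exact: cvk|exact: cvg_cst].
  by rewrite mul1r in h.
have [m _ mP] : \forall m \near \oo, U (iter (k m) D x).
  apply: cvD; exact: open_nbhs_nbhs.
exists (k m); first by case: (kP m).
by exists x; split => //; exact: mP (leqnn m).
Unshelve. all: by end_near.
Qed.

(** * Triangular elimination *)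

(** The iteration updates all entries simultaneously, starting from the constant
sequence [t0]. When [F n] reads only the entries below [n], entry [n] is stable
from step [n.+1] on, so that this solves [u n = F n u]. *)
Definition course_of_values (T : Type) (t0 : T) (F : nat -> (nat -> T) -> T)
    (n : nat) : T :=
  iter n.+1 (fun u m => F m u) (fun=> t0) n.

Lemma course_of_valuesE (T : Type) (t0 : T) (F : nat -> (nat -> T) -> T) :
  (forall n u v, (forall k, (k < n)%N -> u k = v k) -> F n u = F n v) ->
  forall n, @course_of_values T t0 F n = F n (@course_of_values T t0 F).
Proof.
move=> Floc.
pose w m := iter m (fun u m => F m u) (fun=> t0).
suff stable n m m' : (n < m)%N -> (n < m')%N -> w m n = w m' n.
  move=> n; rewrite [LHS]/course_of_values iterS; apply: Floc => k kn.
  exact: (stable k n k.+1).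
elim/ltn_ind: n m m' => n IH [|m] [|m'] // nm nm'.
rewrite /w !iterS; apply: Floc => k kn.
by apply: IH => //; exact: leq_trans kn _.
Qed.

Section Triangular.
Variable K : fieldType.
Implicit Types (c : nat -> nat -> K) (x y : nat -> K).

(** The identity minus the strictly lower triangular part of [c]; its inverse
[unitri_inv] is computed by forward substitution. *)
Definition unitri c y : nat -> K := fun i => y i - \sum_(j < i) c i j * y j.

Definition unitri_inv c x : nat -> K :=
  @course_of_values K 0 (fun i u => x i + \sum_(j < i) c i j * u j).

Lemma unitri_invE c x i :
  unitri_inv c x i = x i + \sum_(j < i) c i j * unitri_inv c x j.
Proof.
apply: course_of_valuesE => n u v uv; congr (_ + _).
by apply: eq_bigr => j _; rewrite uv.
Qed.

Lemma unitri_invK c : cancel (unitri_inv c) (unitri c).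
Proof. by move=> x; apply/funext => i; rewrite /unitri unitri_invE addrK. Qed.

Lemma unitriK c : cancel (unitri c) (unitri_inv c).
Proof.
move=> y; apply/funext; elim/ltn_ind => i IH; rewrite unitri_invE.
by under eq_bigr do rewrite IH //; rewrite subrK.
Qed.

Variable a : nat -> nat -> K.

(** Coefficients of row [n] of [a], without its diagonal entry, in the basis of the
functionals [unitri_inv c ^~ j] for [j < n], instead of the coordinates; see
[mixed_rowE]. *)
Definition mixed_row n (c : nat -> nat -> K) j :=
  a n j - \sum_(k < n | (j < k)%N) a n k * c k j.

(** The coefficients that turn the coordinates into eigenfunctionals of [a] as far
as possible. In the resonant case [a n n = a j j] no coefficient helps, and [0]
is chosen. *)
Definition diagonalizer : nat -> nat -> K :=
  @course_of_values (nat -> K) (fun=> 0) (fun n c j =>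
    if a n n == a j j then 0 else mixed_row n c j / (a n n - a j j)).

Lemma diagonalizerE n j :
  diagonalizer n j =
    if a n n == a j j then 0
    else mixed_row n diagonalizer j / (a n n - a j j).
Proof.
rewrite /diagonalizer course_of_valuesE // => m u v uv; apply/funext => i.
case: ifP => // _; congr (_ / _); congr (_ - _).
by apply: eq_bigr => k _; rewrite uv.
Qed.

Lemma mixed_rowE n c x :
  \sum_(j < n) a n j * x j =
  \sum_(j < n) mixed_row n c j * unitri_inv c x j.
Proof.
under eq_bigr => j _.
  rewrite -[in x j](unitri_invK c x) /unitri mulrBr mulr_sumr.
  rewrite (big_ord_widen_cond n xpredT
    (fun i => a n j * (c j i * unitri_inv c x i))) ?(ltnW (ltn_ord _)) //=.
  over.
rewrite sumrB (exchange_big_dep xpredT) //= -sumrB.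
apply: eq_bigr => j _; rewrite mulrBl mulr_suml; congr (_ - _).
by apply: eq_bigr => k _; rewrite mulrA.
Qed.

(** The resonant part of row [n], which no choice of coefficients can remove. *)
Definition obstruction n x : K :=
  \sum_(j < n | a n n == a j j) mixed_row n diagonalizer j * unitri_inv diagonalizer x j.

(** Here [z] is the image of [x] under [a] as far as coordinate [n] is concerned.
The choice of [diagonalizer] cancels every non-resonant term of row [n]. *)
Lemma unitri_inv_step n x z :
  z n = a n n * x n + \sum_(j < n) a n j * x j ->
  (forall j, (j < n)%N ->
     unitri_inv diagonalizer z j = a j j * unitri_inv diagonalizer x j) ->
  unitri_inv diagonalizer z n =
    a n n * unitri_inv diagonalizer x n + obstruction n x.
Proof.
move=> zn IH; rewrite !(unitri_invE _ _ n) zn (mixed_rowE n diagonalizer).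
rewrite mulrDr -!addrA; congr (_ + _).
rewrite mulr_sumr /obstruction [X in _ = _ + X]big_mkcond -!big_split /=.
apply: eq_bigr => j _; rewrite IH // diagonalizerE.
case: eqVneq => [_|neq]; first by rewrite !mul0r mulr0 addr0 add0r.
have neq0 : a n n - a j j != 0 by rewrite subr_eq0.
by field.
Qed.

(** All eigenfunctionals that occur in the resonant part share the eigenvalue
[a n n]. *)
Lemma obstruction_eigen n x z :
  (forall j, (j < n)%N ->
     unitri_inv diagonalizer z j = a j j * unitri_inv diagonalizer x j) ->
  obstruction n z = a n n * obstruction n x.
Proof.
move=> IH; rewrite /obstruction mulr_sumr; apply: eq_bigr => j /eqP ->.
by rewrite IH // mulrCA.
Qed.

End Triangular.

(** * Diagonalization of recurrent triangular operators *)

Lemma omega_linE (R : realType) (k : C R) (x y : omega R) i :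
  (k *: x + y) i = k * x i + y i.
Proof. by []. Qed.

Lemma continuous_unitri (R : realType) (c : nat -> nat -> C R) :
  continuous (unitri c : omega R -> omega R).
Proof.
apply: (iffRL (continuous_omegaP _)) => i.
rewrite (_ : (fun x => _) =
  (fun x : omega R => x i + \sum_(j < i) (- c i j) * x j)); last first.
  apply/funext => x; rewrite /unitri -sumrN; congr (_ + _).
  by apply: eq_bigr => j _; rewrite mulNr.
apply: (@continuous_add_lin_comb (omega R) (C R) (fun x => x i)
  (fun j x => x j) (fun j => - c i j) i).
- exact: omega_coord_continuous.
- move=> j _; exact: omega_coord_continuous.
Qed.

Lemma continuous_unitri_inv (R : realType) (c : nat -> nat -> C R) :
  continuous (unitri_inv c : omega R -> omega R).
Proof.
apply: (iffRL (continuous_omegaP _)).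
elim/ltn_ind => i IH.
rewrite (_ : (fun x => _) =
  (fun x : omega R => x i + \sum_(j < i) c i j * unitri_inv c x j)); last first.
  by apply/funext => x; rewrite unitri_invE.
apply: (@continuous_add_lin_comb (omega R) (C R) (fun x => x i)
  (fun j x => unitri_inv c x j) (c i) i) => //.
exact: omega_coord_continuous.
Qed.

Lemma linear_unitri (R : realType) (c : nat -> nat -> C R) :
  linear (unitri c : omega R -> omega R).
Proof.
move=> k x y; apply/funext => i; rewrite omega_linE /unitri.
under eq_bigr do rewrite omega_linE mulrDr mulrCA.
by rewrite big_split /= -mulr_sumr mulrBr opprD addrACA.
Qed.

Lemma linear_unitri_inv (R : realType) (c : nat -> nat -> C R) :
  linear (unitri_inv c : omega R -> omega R).
Proof.
move=> k x y; apply: (can_inj (unitriK c)).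
have := linear_unitri c k (unitri_inv c x) (unitri_inv c y).
by rewrite !unitri_invK => /esym.
Qed.

Section Diagonalization.
Variables (R : realType) (A : omega R -> omega R).
Hypotheses (A_L : is_cont_linear A) (A_lower : is_lower_triangular A).
Let a := entry A.
Let c := diagonalizer a.
Let B : omega R -> omega R := unitri c.
Let P : omega R -> omega R := unitri_inv c.

Lemma lower_triangularE x n : A x n = a n n * x n + \sum_(j < n) a n j * x j.
Proof.
rewrite (cont_linear_row (m := n.+1) A_L (@A_lower n)).
by rewrite big_ord_recr addrC.
Qed.

(** Induction on [n]. If the resonant part of row [n] were nonzero, it would form
a Jordan block together with [P _ n]. *)
Lemma unitri_inv_intertwines : recurrent A -> forall n x, P (A x) n = a n n * P x n.
Proof.
move=> recA.
have cP i : continuous (fun x => P x i).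
  by apply: (iffLR (continuous_omegaP P)); exact: continuous_unitri_inv.
elim/ltn_ind => n IH.
have step x : P (A x) n = a n n * P x n + obstruction a n x.
  apply: unitri_inv_step => [|j jn]; [exact: lower_triangularE|exact: IH].
have obsA x : obstruction a n (A x) = a n n * obstruction a n x.
  by apply: obstruction_eigen => j jn; exact: IH.
have [h0|/existsNP[x0 /eqP hx0]] := pselect (forall x, obstruction a n x = 0).
  by move=> x; rewrite step h0 addr0.
exfalso.
(* The resonant part sees only coordinates below n of the image under P, so it
   can be given any value while coordinate n is kept at 0. *)
pose y z : omega R := fun j =>
  if (j < n)%N then z / obstruction a n x0 * P x0 j else 0.
have hy z : obstruction a n (B (y z)) = z.
  rewrite -[RHS](divfK hx0) /obstruction mulr_sumr.
  apply: eq_bigr => j _; rewrite unitriK /y ltn_ord mulrCA //.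
have Py z : P (B (y z)) n = 0 by rewrite /P unitriK /y ltnn.
have ch : continuous (obstruction a n : omega R -> C R).
  rewrite (_ : obstruction a n = fun x => \sum_(j < n)
      (if a n n == a j j then mixed_row a n c j else 0) * P x j).
    apply: (@continuous_lin_comb (omega R) (C R) (fun j x => P x j)
      (fun j => if a n n == a j j then mixed_row a n c j else 0) n) => j _.
    exact: cP.
  apply/funext => x; rewrite /obstruction big_mkcond; apply: eq_bigr => j _.
  by case: ifP => //; rewrite mul0r.
have lam1 : `|a n n| = 1.
  by apply: (recurrent_eigenvalue recA ch obsA) => z; exists (B (y z)).
have := recurrent_no_jordan recA ch (cP n) lam1 obsA step (Py 2).
by rewrite hy normr_nat lern1.
Qed.

Lemma diagonal_norm1 : recurrent A -> forall n, `|a n n| = 1.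
Proof.
move=> recA n.
apply: (@recurrent_eigenvalue _ _ A (fun x => P x n) (a n n) recA).
- by apply: (iffLR (continuous_omegaP P)); exact: continuous_unitri_inv.
- exact: unitri_inv_intertwines.
- by move=> z; exists (B (fun=> z)); rewrite /P /B unitriK.
Qed.

End Diagonalization.

Theorem theorem3p12 (R : realType) (A : omega R -> omega R)
    (A_L : is_cont_linear A) (A_lower : is_lower_triangular A) :
  recurrent A <->
  exists B D Binv : omega R -> omega R,
    [/\ is_cont_linear B,
        is_cont_linear Binv,
        cancel B Binv /\ cancel Binv B,
        [/\ is_cont_linear D,
            is_diagonal D
          & forall i : nat, `|entry D i i| = 1]
      & A = B \o D \o Binv].
Proof.
split=> [recA|[B [D [Binv [[_ cB] _ [BK BinvK] [D_L D_diag D1] ->]]]]]; last first.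
  apply: recurrent_conj => //; apply: (recurrent_diagonal D1) => x i.
  rewrite (@lower_triangularE _ D D_L) => [|j k jk]; last by rewrite D_diag ?ltn_eqF.
  by rewrite big1 ?addr0 // => j _; rewrite D_diag ?mul0r // gtn_eqF.
pose c := diagonalizer (entry A).
pose D (x : omega R) : omega R := fun i => entry A i i * x i.
have DE i j : entry D i j = entry A i i * (i == j)%:R by [].
exists (unitri c), D, (unitri_inv c); split.
- by split; [exact: linear_unitri|exact: continuous_unitri].
- by split; [exact: linear_unitri_inv|exact: continuous_unitri_inv].
- by split; [exact: unitriK|exact: unitri_invK].
- split=> [|i j /negPf ij|i]; last 2 first.
  + by rewrite DE ij mulr0.
  + by rewrite DE eqxx mulr1 diagonal_norm1.
  split=> [k x y|].
    by apply/funext => i; rewrite omega_linE /D omega_linE mulrDr mulrCA.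
  apply: (iffRL (continuous_omegaP _)) => i.
  apply: (@continuous_scale (omega R) (C R) (fun x => x i)).
  exact: omega_coord_continuous.
- apply/funext => x /=; apply: (can_inj (unitri_invK c)); rewrite unitriK.
  by apply/funext => n; exact: unitri_inv_intertwines.
Qed.
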